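(* For integers $r\ge s\ge 0$ with $r\ge 1$, $$b_{(r,s)}(q)=\begin{cases}\sum_{i=0}^{s} f_{(r+i,s-i)}\,q^i & \text{if } r>s,\\ \sum_{i=0}^{s-1} f_{(r+i,s-1-i)}\,q^i & \text{if } r=s.\end{cases}$$
   Context: For integers $a\ge b\ge 0$, $f_{(a,b)}$ is the number of standard tableaux of shape $(a,b)$ (shape $(a)$ when $b=0$). For a standard tableau $T$ of shape $\lambda$ (filling by $1,\dots,|\lambda|$ with rows and columns increasing) and $2\le j\le\lambda_i$, $c_{ij}(T)=\#\{i'\ge i:\text{cell }(i',j-1)\text{ exists and }T_{i',j-1}<T_{ij}\}$, $c_q(T)=\prod_i\prod_{j=2}^{\lambda_i}[c_{ij}(T)]_q$ with $[a]_q=1+q+\dots+q^{a-1}$, and $b_\lambda(q)=\sum_T c_q(T)$ over standard tableaux of shape $\lambda$; $b_{(r,0)}$ means $b_{(r)}$. *)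

(* Defs.v *)
From HB Require Import structures.
From mathcomp Require Import all_boot all_order all_algebra.

Set Implicit Arguments.
Unset Strict Implicit.
Unset Printing Implicit Defensive.

Import GRing.Theory.
Local Open Scope ring_scope.

(* Cells of the diagram with row lengths [sh]; row and column indices are
   0-based, so the cell (i, j) of the text is (i - 1, j - 1) here. *)
Definition cell (sh : seq nat) : finType :=
  {i : 'I_(size sh) & 'I_(nth 0%N sh i)}.

Definition crow (sh : seq nat) (c : cell sh) : nat := val (tag c).
Definition ccol (sh : seq nat) (c : cell sh) : nat := val (tagged c).

Definition filling (sh : seq nat) : finType :=
  {ffun cell sh -> 'I_(sumn sh).+1}.

(* There are [sumn sh] cells, so an injective filling with nonzero entries
   uses each of 1, ..., |sh| exactly once. *)
Definition standard (sh : seq nat) (T : filling sh) : bool :=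
  [&& injectiveb T,
      [forall c, (0 < T c)%N],
      [forall c, forall d,
         (crow c == crow d) && (ccol c < ccol d)%N ==> (T c < T d)%N]
    & [forall c, forall d,
         (ccol c == ccol d) && (crow c < crow d)%N ==> (T c < T d)%N]].

Definition nb_standard (sh : seq nat) : nat :=
  #|[set T : filling sh | standard T]|.

Definition cnum (sh : seq nat) (T : filling sh) (c : cell sh) : nat :=
  #|[set d : cell sh | [&& (crow c <= crow d)%N, (ccol d).+1 == ccol c
                         & (T d < T c)%N]]|.

(* The indeterminate q is 'X. *)
Definition qint (a : nat) : {poly int} := \sum_(k < a) 'X^k.

(* [0 < ccol c] is the condition j >= 2 of the 1-based text. *)
Definition cq (sh : seq nat) (T : filling sh) : {poly int} :=
  \prod_(c : cell sh | (0 < ccol c)%N) qint (cnum T c).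

Definition bpoly (sh : seq nat) : {poly int} :=
  \sum_(T : filling sh | standard T) cq T.

Definition two_row (a b : nat) : seq nat :=
  if b == 0%N then [:: a] else [:: a; b].

(* Main.v *)
(** Let [n] be the size of the shape.  The entry [n] of a standard tableau sits
    in a corner; removing it leaves a standard tableau of the smaller shape,
    does not change the number [c_ij] of any other cell, and the number [c_ij]
    of the corner itself depends only on the shape, since [n] exceeds every
    other entry.  For two rows this number is 1, except for the last cell of
    the first row of [(s+1, s)] with [s > 0], where it is 2.  Hence
    [b(a, b) = b(a-1, b) + b(a, b-1)], with [b(a-1, b)] multiplied by [1 + q]
    when [a = b + 1] and dropped when [a = b]; the numbers [f] satisfy the same
    recurrence at [q = 0], and comparing coefficients of [q^k] closes the
    induction. *)

Require Import Defs.
From HB Require Import structures.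
From mathcomp Require Import all_boot all_order all_algebra.
From mathcomp Require Import zify.

Set Implicit Arguments.
Unset Strict Implicit.
Unset Printing Implicit Defensive.

Import GRing.Theory.
Local Open Scope ring_scope.

(** * Cells and standard fillings of an arbitrary shape *)

Section Cells.
Variable sh : seq nat.
Implicit Types c d : cell sh.

Lemma ccol_lt c : (ccol c < nth 0%N sh (crow c))%N.
Proof. exact: ltn_ord. Qed.

Lemma crow_size i j : (j < nth 0%N sh i)%N -> (i < size sh)%N.
Proof. by apply: contraLR; rewrite -!leqNgt => /(nth_default 0%N) ->. Qed.

Definition mkcell i j (h : (j < nth 0%N sh i)%N) : cell sh :=
  @Tagged _ (Ordinal (crow_size h)) (fun i : 'I_(size sh) => 'I_(nth 0%N sh i))
    (@Ordinal (nth 0%N sh (Ordinal (crow_size h))) j h).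

Lemma crow_mkcell i j h : crow (@mkcell i j h) = i. Proof. by []. Qed.
Lemma ccol_mkcell i j h : ccol (@mkcell i j h) = j. Proof. by []. Qed.

Lemma cell_eqP c d : reflect (crow c = crow d /\ ccol c = ccol d) (c == d).
Proof.
apply: (iffP eqP) => [->//|].
case: c => i j; case: d => i' j'; rewrite /crow /ccol /= => -[/val_inj eqi].
by subst i' => /val_inj ->.
Qed.

Lemma card_cell : #|{: cell sh}| = sumn sh.
Proof.
rewrite card_tagged; congr sumn.
apply: (@eq_from_nth _ 0%N) => [|i]; rewrite size_map size_enum_ord // => lti.
by rewrite (nth_map (Ordinal lti)) ?size_enum_ord // card_ord nth_enum_ord.
Qed.

Variant standard_spec (T : filling sh) : Prop := StandardSpec of
  injective T & (forall c, 0 < T c)%N &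
  (forall c d, crow c = crow d -> ccol c < ccol d -> T c < T d)%N &
  (forall c d, ccol c = ccol d -> crow c < crow d -> T c < T d)%N.

Lemma standardP T : reflect (standard_spec T) (standard T).
Proof.
apply: (iffP and4P) => [[/injectiveP iT /forallP pT rT cT]|[iT pT rT cT]].
  split=> // c d eqcd ltcd.
    by have /forallP/(_ d)/implyP := forallP rT c; rewrite eqcd eqxx; apply.
  by have /forallP/(_ d)/implyP := forallP cT c; rewrite eqcd eqxx; apply.
split; [exact/injectiveP | exact/forallP | |];
  by apply/forallP=> c; apply/forallP=> d; apply/implyP=> /andP[/eqP]; auto.
Qed.

(** The entries avoid 0 and are distinct, and there are as many cells as nonzero values, so every
    nonzero value occurs. *)
Lemma standard_max_attained T :
  (0 < sumn sh)%N -> standard T -> exists c, T c = ord_max.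
Proof.
move=> sh_gt0 /standardP[iT pT _ _].
have sub : codom T \subset predC1 ord0.
  by apply/subsetP=> _ /codomP[c ->]; rewrite inE -val_eqE /= -lt0n.
have eq_card : #|codom T| = #|predC1 (@ord0 (sumn sh))|.
  by rewrite card_codom // card_cell cardC1 card_ord.
have /subset_cardP/(_ sub)/(_ ord_max) := eq_card.
by rewrite !inE -val_eqE /= -lt0n sh_gt0 => /codomP[c ->]; exists c.
Qed.

Lemma standard_max_corner T c d : standard T -> T c = ord_max ->
  ((crow c == crow d) && (ccol c < ccol d) = false)%N *
  ((ccol c == ccol d) && (crow c < crow d) = false)%N.
Proof.
case/standardP=> _ _ rT cT Tc; split; apply/negP=> /andP[/eqP e l].
  by have := rT _ _ e l; rewrite Tc ltnNge -ltnS ltn_ord.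
by have := cT _ _ e l; rewrite Tc ltnNge -ltnS ltn_ord.
Qed.

End Cells.

(* [bpoly] for [w = qint], and the number of standard tableaux for [w = 1]. *)
Definition tsum (R : comNzRingType) (w : nat -> R) (sh : seq nat) : R :=
  \sum_(T : filling sh | standard T)
    \prod_(c : cell sh | (0 < ccol c)%N) w (cnum T c).

Lemma tsum_qint sh : tsum qint sh = bpoly sh. Proof. by []. Qed.

Lemma tsum1 (R : comNzRingType) sh :
  tsum (fun=> 1 : R) sh = (nb_standard sh)%:R.
Proof.
rewrite /tsum (eq_bigr (fun=> 1 : R)) => [|T _]; last exact: big1.
by rewrite sumr_const; congr _%:R; apply: eq_card => T; rewrite !inE.
Qed.

(** * Removing a corner from an arbitrary shape *)

Section RemoveCorner.
Variables (sh sh' : seq nat) (i0 j0 : nat).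
(** Row lengths are compared through [nth] with default 0, so the added corner may also open a new
    row, as from [[:: a]] to [[:: a; 1]]. *)
Hypothesis sh_sh' : forall i j,
  (j < nth 0 sh i)%N = (j < nth 0 sh' i)%N || (i == i0) && (j == j0).
Hypothesis nth_sh' : nth 0%N sh' i0 = j0.
Hypothesis corner : forall i, (i0 < i -> nth 0 sh i <= j0)%N.
Hypothesis sumn_sh : sumn sh = (sumn sh').+1.

Let c0_lt : (j0 < nth 0 sh i0)%N.
Proof. by rewrite sh_sh' !eqxx orbT. Qed.

Definition corner_cell : cell sh := mkcell c0_lt.
Notation c0 := corner_cell.

Let incl_lt (c : cell sh') : (ccol c < nth 0 sh (crow c))%N.
Proof. by rewrite sh_sh' ccol_lt. Qed.

Definition incl (c : cell sh') : cell sh := mkcell (incl_lt c).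
Definition unincl (c : cell sh) : option (cell sh') :=
  [pick d | incl d == c].

Lemma incl_inj : injective incl.
Proof. by move=> c d /eqP/cell_eqP ?; apply/eqP/cell_eqP. Qed.

Lemma incl_neq c : incl c != c0.
Proof.
apply/cell_eqP; rewrite !crow_mkcell !ccol_mkcell => -[ei ej].
by have := ccol_lt c; rewrite ei ej nth_sh' ltnn.
Qed.

Lemma inclK c : unincl (incl c) = Some c.
Proof.
rewrite /unincl; case: pickP => [d /eqP/incl_inj -> // | /(_ c)].
by rewrite eqxx.
Qed.

Lemma unincl_corner : unincl c0 = None.
Proof.
rewrite /unincl; case: pickP => // d /eqP e.
by have := incl_neq d; rewrite e eqxx.
Qed.

Variant cell_spec : cell sh -> Prop :=
  | CellCorner : cell_spec c0
  | CellIncl c : cell_spec (incl c).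

Lemma cellP c : cell_spec c.
Proof.
have := ccol_lt c; rewrite sh_sh' => /orP[lt_c|/andP[/eqP ei /eqP ej]].
  have /eqP -> : c == incl (mkcell lt_c) by apply/cell_eqP.
  exact: CellIncl.
have /eqP -> : c == c0 by apply/cell_eqP.
exact: CellCorner.
Qed.

Definition add_max (T : filling sh') : filling sh :=
  [ffun c => if unincl c is Some d then inord (T d) else ord_max].
(** An entry equal to the maximum does not fit the smaller range and [inord] sends it to 0;
    [del_maxK] therefore asks for the maximum to sit at the corner. *)
Definition del_max (T : filling sh) : filling sh' :=
  [ffun c => inord (T (incl c))].

Lemma add_max_incl T c : add_max T (incl c) = T c :> nat.
Proof.
rewrite ffunE inclK inordK // sumn_sh ltnS.
exact: ltnW (ltn_ord _).
Qed.

Lemma add_max_corner T : add_max T c0 = ord_max.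
Proof. by rewrite ffunE unincl_corner. Qed.

Lemma add_max_lt T c : (add_max T (incl c) < add_max T c0)%N.
Proof. by rewrite add_max_corner add_max_incl /= [X in (_ < X)%N]sumn_sh. Qed.

Lemma add_maxK : cancel add_max del_max.
Proof. by move=> T; apply/ffunP=> c; rewrite ffunE add_max_incl inord_val. Qed.

Lemma del_maxK T : standard T -> T c0 = ord_max -> add_max (del_max T) = T.
Proof.
case/standardP=> iT _ _ _ Tmax; apply/ffunP=> c; apply: val_inj.
case: (cellP c) => [|{}c]; first by rewrite add_max_corner Tmax.
rewrite /= add_max_incl ffunE inordK // -[X in (_ < X)%N]sumn_sh.
rewrite ltn_neqAle -ltnS ltn_ord andbT.
have : T (incl c) != T c0 by rewrite (inj_eq iT) incl_neq.
by rewrite Tmax -val_eqE.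
Qed.

(** No cell lies to the right of the corner, by [nth_sh'], or below it, by [corner], so a maximal
    entry there violates no inequality. *)
Lemma standard_add_max T : standard (add_max T) = standard T.
Proof.
apply/standardP/standardP=> -[iT pT rT cT]; split.
- move=> c d eT; apply/incl_inj/iT/val_inj; by rewrite /= !add_max_incl eT.
- by move=> c; rewrite -add_max_incl.
- by move=> c d e l; rewrite -!add_max_incl; apply: rT.
- by move=> c d e l; rewrite -!add_max_incl; apply: cT.
- move=> c d; case: (cellP c) => [|{}c]; case: (cellP d) => [|{}d] // eT.
  + by have := add_max_lt T d; rewrite -eT ltnn.
  + by have := add_max_lt T c; rewrite eT ltnn.
  + by congr incl; apply/iT/val_inj; rewrite /= -!add_max_incl eT.
- move=> c; case: (cellP c) => [|{}c]; last by rewrite add_max_incl.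
  by rewrite add_max_corner /= sumn_sh.
- move=> c d; case: (cellP c) => [|{}c]; case: (cellP d) => [|{}d].
  + by rewrite ltnn.
  + rewrite !crow_mkcell !ccol_mkcell => e l.
    by have := ccol_lt d; rewrite -e nth_sh' ltnNge (ltnW l).
  + by rewrite add_max_lt.
  + by rewrite !add_max_incl; apply: rT.
- move=> c d; case: (cellP c) => [|{}c]; case: (cellP d) => [|{}d].
  + by rewrite ltnn.
  + rewrite !crow_mkcell !ccol_mkcell => e l.
    by have := ccol_lt (incl d); rewrite ccol_mkcell -e ltnNge corner.
  + by rewrite add_max_lt.
  + by rewrite !add_max_incl; apply: cT.
Qed.

Lemma cnum_add_max T c : cnum (add_max T) (incl c) = cnum T c.
Proof.
rewrite /cnum -(card_imset _ incl_inj); congr #|pred_of_set _|.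
apply/setP=> d; rewrite !inE; case: (cellP d) => [|{}d].
  rewrite [(add_max T c0 < _)%N]ltnNge (ltnW (add_max_lt T c)) !andbF.
  by apply/esym/imsetP=> -[e _ /esym/eqP]; rewrite (negPf (incl_neq e)).
by rewrite (mem_imset _ _ incl_inj) inE !add_max_incl.
Qed.

(** This is [cnum] at the corner with the comparison of entries dropped, since the maximum exceeds
    all of them. *)
Definition cnum_corner : nat :=
  #|[set d : cell sh | (i0 <= crow d)%N && ((ccol d).+1 == j0)]|.

Lemma cnum_add_max_corner T : cnum (add_max T) c0 = cnum_corner.
Proof.
apply: eq_card => d; rewrite !inE crow_mkcell ccol_mkcell.
case: (cellP d) => [|{}d]; first by rewrite ltnn ccol_mkcell gtn_eqF ?andbF.
by rewrite add_max_lt andbT.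
Qed.

Lemma prod_add_max (R : comNzRingType) (w : nat -> R) T :
  \prod_(c : cell sh | (0 < ccol c)%N) w (cnum (add_max T) c) =
  (if (0 < j0)%N then w cnum_corner else 1) *
    \prod_(c : cell sh' | (0 < ccol c)%N) w (cnum T c).
Proof.
rewrite big_mkcond (bigD1 c0) //= ccol_mkcell cnum_add_max_corner.
congr (_ * _); rewrite (reindex_omap incl unincl) /= => [|c]; last first.
  by case: (cellP c) => [|d _]; rewrite ?eqxx // inclK.
rewrite [RHS]big_mkcond; apply: eq_big => [c|c _].
  by rewrite incl_neq inclK eqxx.
by rewrite cnum_add_max.
Qed.

(** [add_max] and [del_max] are mutually inverse between the two sets of tableaux. For [j0 = 0] the
    corner lies in the first column and contributes no factor. *)
Lemma tsum_corner (R : comNzRingType) (w : nat -> R) :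
  \sum_(T : filling sh | standard T && (T c0 == ord_max))
    \prod_(c : cell sh | (0 < ccol c)%N) w (cnum T c) =
  (if (0 < j0)%N then w cnum_corner else 1) * tsum w sh'.
Proof.
rewrite (reindex_onto add_max del_max) => [|T /andP[sT /eqP]].
  2: exact: del_maxK.
rewrite /tsum mulr_sumr; apply: eq_big => [T|T _]; last exact: prod_add_max.
by rewrite standard_add_max add_max_corner add_maxK !eqxx !andbT.
Qed.

End RemoveCorner.

(** * Two-row shapes and their recurrence for a general weight *)

Lemma cnum_corner1 sh i0 j : (j < nth 0 sh i0)%N ->
  (forall i, i0 < i -> nth 0 sh i <= j)%N -> cnum_corner sh i0 j.+1 = 1%N.
Proof.
move=> lt_j below; rewrite -(cards1 (mkcell lt_j)); apply: eq_card => d.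
rewrite !inE eqSS.
apply/andP/cell_eqP; rewrite crow_mkcell ccol_mkcell; last by case=> -> ->.
(* Lower rows end before column [j], so only row [i0] meets that column. *)
case; rewrite leq_eqVlt => /predU1P[-> /eqP -> //|lt_d /eqP ej].
by have := leq_trans (ccol_lt d) (below _ lt_d); rewrite ej ltnn.
Qed.

Lemma nth_two_row a b i : nth 0%N (two_row a b) i = nth 0%N [:: a; b] i.
Proof.
rewrite /two_row; case: eqP => // ->.
by case: i => [|[|i]] //=; rewrite !nth_nil.
Qed.

Lemma sumn_two_row a b : sumn (two_row a b) = (a + b)%N.
Proof. by rewrite /two_row; case: eqP => [->|_] /=; lia. Qed.

(** The column just left of the corner meets both rows. *)
Lemma cnum_corner2 a : cnum_corner (two_row a.+2 a.+1) 0 a.+1 = 2%N.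
Proof.
have l0 : (a < nth 0 (two_row a.+2 a.+1) 0)%N by [].
have l1 : (a < nth 0 (two_row a.+2 a.+1) 1)%N by [].
have ne : mkcell l0 != mkcell l1 by apply/cell_eqP=> -[].
rewrite -(_ : #|[set mkcell l0; mkcell l1]| = 2%N); last by rewrite cards2 ne.
apply: eq_card => d; rewrite !inE eqSS /=.
apply/eqP/orP=> [e|[] /cell_eqP[]] //.
have := ccol_lt d; rewrite nth_two_row.
case e1: (crow d) => [|[|i]] /=; rewrite ?nth_nil // => _.
  by left; apply/cell_eqP.
by right; apply/cell_eqP.
Qed.

Section TwoRowRecurrence.
Variables (R : comNzRingType) (w : nat -> R).
Hypothesis w1 : w 1%N = 1.

Lemma tsum_two_row00 : tsum w (two_row 0 0) = 1.
Proof.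
have nocell (c : cell (two_row 0 0)) : False.
  have := ccol_lt c; rewrite nth_two_row.
  by case: (crow c) => [|[|i]] //=; rewrite nth_nil.
rewrite /tsum (big_pred1 [ffun=> ord0]) => [|T].
  by rewrite big1 // => c; case: (nocell c).
have -> : T = [ffun=> ord0] by apply/ffunP=> c; case: (nocell c).
by rewrite /= eqxx; apply/standardP; split=> c; case: (nocell c).
Qed.

(** The corner is given by its coordinates only, which hides the proofs inside [corner_cell]. *)
Lemma tsum_two_row_top a b : (b <= a)%N ->
  exists2 c : cell (two_row a.+1 b), crow c = 0%N /\ ccol c = a &
  \sum_(T : filling (two_row a.+1 b) | standard T && (T c == ord_max))
    \prod_(c | (0 < ccol c)%N) w (cnum T c) =
  (if (0 < b)%N && (b == a) then w 2%N else 1) * tsum w (two_row a b).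
Proof.
move=> le_ba.
have H i j : (j < nth 0 (two_row a.+1 b) i)%N =
    (j < nth 0 (two_row a b) i)%N || (i == 0%N) && (j == a).
  by rewrite !nth_two_row; case: i => [|[|i]] /=; rewrite ?nth_nil; lia.
have H1 : nth 0%N (two_row a b) 0 = a by rewrite nth_two_row.
have H2 i : (0 < i -> nth 0 (two_row a.+1 b) i <= a)%N.
  by rewrite nth_two_row; case: i => [|[|i]] //=; rewrite nth_nil.
have H3 : sumn (two_row a.+1 b) = (sumn (two_row a b)).+1.
  by rewrite !sumn_two_row.
exists (corner_cell H) => //; rewrite tsum_corner //; congr (_ * _).
(* For [a = 0] the corner is in the first column; otherwise its factor depends on whether the second
   row reaches the column before it. *)
case: a le_ba {H H1 H2 H3} => [|a]; first by case: b.
rewrite ltnS leq_eqVlt ltnS /= => /predU1P[->|lt_ba].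
  by rewrite eqxx cnum_corner2.
rewrite cnum_corner1 ?nth_two_row //= ?w1; first by case: ifP => //; lia.
by move=> i; rewrite nth_two_row; case: i => [|[|i]] //=; rewrite nth_nil.
Qed.

Lemma tsum_two_row_bot a b : (b < a)%N ->
  exists2 c : cell (two_row a b.+1), crow c = 1%N /\ ccol c = b &
  \sum_(T : filling (two_row a b.+1) | standard T && (T c == ord_max))
    \prod_(c | (0 < ccol c)%N) w (cnum T c) = tsum w (two_row a b).
Proof.
move=> lt_ba.
have H i j : (j < nth 0 (two_row a b.+1) i)%N =
    (j < nth 0 (two_row a b) i)%N || (i == 1%N) && (j == b).
  by rewrite !nth_two_row; case: i => [|[|i]] /=; rewrite ?nth_nil; lia.
have H1 : nth 0%N (two_row a b) 1 = b by rewrite nth_two_row.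
have H2 i : (1 < i -> nth 0 (two_row a b.+1) i <= b)%N.
  by rewrite nth_two_row; case: i => [|[|i]] //=; rewrite nth_nil.
have H3 : sumn (two_row a b.+1) = (sumn (two_row a b)).+1.
  by rewrite !sumn_two_row addnS.
exists (corner_cell H) => //; rewrite tsum_corner // -[RHS]mul1r; congr (_ * _).
case: b lt_ba {H H1 H2 H3} => [|b] lt_ba //.
rewrite cnum_corner1 ?w1 ?nth_two_row //= => i.
by rewrite nth_two_row; case: i => [|[|i]] //=; rewrite nth_nil.
Qed.

(** A right neighbour, or for [a = b] the cell below the end of the first row, would have to exceed
    the maximum. *)
Lemma standard_max_two_row a b (T : filling (two_row a b)) :
  (0 < a)%N -> (b <= a)%N -> standard T ->
  exists2 c, T c = ord_max &
    (crow c = 0%N /\ (ccol c).+1 = a /\ (b < a)%N) \/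
    (crow c = 1%N /\ (ccol c).+1 = b).
Proof.
move=> a_gt0 le_ba sT.
have [|c Tc] := standard_max_attained _ sT; first by rewrite sumn_two_row; lia.
exists c => //; have := ccol_lt c; rewrite nth_two_row.
case e: (crow c) => [|[|i]] /=; rewrite ?nth_nil // => lt_c.
  left; split=> //; have corner i j (l : (j < nth 0 (two_row a b) i)%N) :=
    standard_max_corner (mkcell l) sT Tc.
  have ea : (ccol c).+1 = a.
    apply/eqP; rewrite eqn_leq lt_c leqNgt; apply/negP=> lt_ca.
    have l : ((ccol c).+1 < nth 0 (two_row a b) 0)%N by rewrite nth_two_row.
    by have [] := corner _ _ l; rewrite e crow_mkcell ccol_mkcell eqxx ltnSn.
  split=> //; rewrite ltnNge; apply/negP=> le_ab.
  have l : (ccol c < nth 0 (two_row a b) 1)%N by rewrite nth_two_row /=; lia.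
  by have [] := corner _ _ l; rewrite e crow_mkcell ccol_mkcell eqxx.
right; split=> //; apply/eqP; rewrite eqn_leq lt_c leqNgt; apply/negP=> lt_cb.
have l : ((ccol c).+1 < nth 0 (two_row a b) 1)%N by rewrite nth_two_row.
have [] := standard_max_corner (mkcell l) sT Tc.
by rewrite e crow_mkcell ccol_mkcell eqxx ltnSn.
Qed.

Lemma tsum_two_rowS0 a : tsum w (two_row a.+1 0) = tsum w (two_row a 0).
Proof.
have [c [ci cj]] := @tsum_two_row_top a 0 isT.
rewrite mul1r => <-; apply: eq_bigl => T.
case sT: (standard T) => //=; apply/esym/eqP.
have [//|//|d Td dP] := standard_max_two_row _ _ sT.
by rewrite -Td; congr (T _); apply/eqP/cell_eqP; lia.
Qed.

Lemma tsum_two_row_square a :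
  tsum w (two_row a.+1 a.+1) = tsum w (two_row a.+1 a).
Proof.
have [c [ci cj] <-] := tsum_two_row_bot (ltnSn a).
apply: eq_bigl => T; case sT: (standard T) => //=; apply/esym/eqP.
have [//|//|d Td dP] := standard_max_two_row _ _ sT.
by rewrite -Td; congr (T _); apply/eqP/cell_eqP; lia.
Qed.

(** The sum splits according to which of the two corners holds the maximum. *)
Lemma tsum_two_rowSS a b : (b < a)%N ->
  tsum w (two_row a.+1 b.+1) =
  (if b.+1 == a then w 2%N else 1) * tsum w (two_row a b.+1) +
    tsum w (two_row a.+1 b).
Proof.
move=> lt_ba; have [c [ci cj] /= <-] := tsum_two_row_top lt_ba.
have [d [di dj] <-] := tsum_two_row_bot (ltnW lt_ba : b < a.+1)%N.
rewrite /tsum (bigID (fun T : filling _ => T c == ord_max)) /=; congr (_ + _).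
apply: eq_bigl => T; case sT: (standard T) => //=.
have [//||e Te eP] := standard_max_two_row _ _ sT; first by lia.
have ne : d != c by apply/cell_eqP; lia.
have iT : injective T by case/standardP: sT.
(* By injectivity, the maximum is missing from [c] exactly when it is at [d]. *)
rewrite -Te !(inj_eq iT); case: eP => eP.
  have /eqP -> : e == c by apply/cell_eqP; lia.
  by rewrite eqxx (negPf ne).
have /eqP -> : e == d by apply/cell_eqP; lia.
by rewrite eqxx eq_sym ne.
Qed.

End TwoRowRecurrence.

(** * Tableau counts and comparison of coefficients *)

Lemma nb_standard_row a : nb_standard (two_row a 0) = 1%N.
Proof.
(* The weighted sums need a ring, so the count is cast to [int], where distinct naturals stay
   distinct. *)
apply/eqP; rewrite -(Num.Theory.eqr_nat int) -tsum1.
by elim: a => [|a IH]; rewrite ?tsum_two_row00 ?tsum_two_rowS0.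
Qed.

Lemma nb_standard_square a :
  nb_standard (two_row a.+1 a.+1) = nb_standard (two_row a.+1 a).
Proof.
by apply/eqP; rewrite -(Num.Theory.eqr_nat int) -!tsum1 tsum_two_row_square.
Qed.

Lemma nb_standardSS a b : (b < a)%N ->
  nb_standard (two_row a.+1 b.+1) =
  (nb_standard (two_row a b.+1) + nb_standard (two_row a.+1 b))%N.
Proof.
move=> lt_ba; apply/eqP; rewrite -(Num.Theory.eqr_nat int) natrD -!tsum1.
by rewrite tsum_two_rowSS // if_same mul1r.
Qed.

Lemma qint1 : qint 1 = 1. Proof. by rewrite /qint big_ord1. Qed.

Lemma qint2 : qint 2 = 1 + 'X.
Proof. by rewrite /qint big_ord_recl big_ord1. Qed.

(** Induction on [s], then on [r], with the recurrence for the counts applied to each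
    coefficient. *)
Lemma bpoly_two_row_strict r s : (s < r)%N ->
  bpoly (two_row r s) =
  \poly_(i < s.+1) ((nb_standard (two_row (r + i) (s - i)))%:R : int).
Proof.
elim: s r => [|s IHs] r lt_sr.
  have -> : bpoly (two_row r 0) = 1.
    elim: {lt_sr}r => [|r IH]; rewrite -tsum_qint ?tsum_two_row00 //.
    by rewrite tsum_two_rowS0 ?qint1.
  by apply/polyP=> -[|k]; rewrite coef_poly coef1 //= nb_standard_row.
elim: r lt_sr => // a IHa; rewrite ltnS => lt_sa.
rewrite -tsum_qint tsum_two_rowSS ?qint1 ?qint2 // !tsum_qint.
rewrite (IHs a.+1); last by lia.
have [eq_sa|ne_sa] := eqVneq s.+1 a.
  (* Here the recurrence meets the square shape, outside the inner hypothesis; it is traded for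
     [two_row s.+1 s], covered by the outer one. *)
  rewrite -eq_sa -tsum_qint tsum_two_row_square ?qint1 // tsum_qint IHs //.
  apply/polyP=> k; rewrite mulrDl mul1r !coefD coefXM !coef_poly.
  have [lt_ks|lt_sk|->] := ltngtP k s.+1; last first.
  (* The top coefficient comes from the factor ['X] alone; both sides count tableaux of a single
     row. *)
  - rewrite ltnSn /= ltnSn add0r addr0.
    by rewrite subnn nb_standard_row subnn nb_standard_row.
  - by case: k lt_sk => // k lt_sk; rewrite /= !ifF ?addr0 //; lia.
  rewrite [RHS]ifT; last by lia.
  rewrite subSn // [in RHS]addSn [in RHS]nb_standardSS; last by lia.
  rewrite natrD; congr (_ + _).
  (* The factor [1 + 'X] gives two terms, which a second use of the count recurrence recombines; at
     degree 0 there is one term, matched by the square identity. *)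
  case: k lt_ks => [|k] lt_ks /=.
    by rewrite addr0 addn0 subn0 nb_standard_square.
  rewrite ifT; last by lia.
  rewrite [in RHS]addnS [in RHS]nb_standardSS; last by lia.
  rewrite natrD addrC.
  by congr (_%:R + _%:R); congr (nb_standard (two_row _ _)); lia.
(* Away from the diagonal the factor is 1 and one use of the count recurrence per coefficient
   suffices. *)
rewrite mul1r IHa; last by lia.
apply/polyP=> k; rewrite !coefD !coef_poly.
have [lt_ks|lt_sk|->] := ltngtP k s.+1; last first.
- by rewrite ltnSn subnn !nb_standard_row addr0.
- by rewrite !ifF ?addr0 //; lia.
rewrite !ifT; try by lia.
by rewrite subSn // [in RHS]addSn [in RHS]nb_standardSS ?natrD //; lia.
Qed.

Theorem theorem3p21 (r s : nat) (hrs : (s <= r)%N) (hr : (1 <= r)%N) :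
  bpoly (two_row r s) =
    if (s < r)%N
    then \sum_(i < s.+1) (nb_standard (two_row (r + i) (s - i)))%:R *: 'X^i
    else \sum_(i < s) (nb_standard (two_row (r + i) (s - 1 - i)))%:R *: 'X^i.
Proof.
case: ltnP => [lt_sr|le_rs]; first by rewrite bpoly_two_row_strict // poly_def.
have /eqP -> : s == r by rewrite eqn_leq hrs.
case: r hr {hrs le_rs} => // r _.
(* In a square shape the maximum must end the second row; removing it leaves the strict case with
   [s - 1]. *)
rewrite -tsum_qint tsum_two_row_square ?qint1 // tsum_qint.
by rewrite bpoly_two_row_strict // poly_def subn1.
Qed.
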